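(* Let $X$, $Y$ be Banach spaces and let $V$ be a subspace of $X$ such that the space $\mathcal{L}(V,Y)$ is separable. Let $G\subset X$ be an open set and $f: G \to Y$ a continuous mapping. Then the set $A$ of all $a \in G$ such that the Fréchet derivative $f'_V(a)$ of $f$ at $a$ along $V$ exists and $f$ is not strictly differentiable at $a$ along $V$ is a first category set.
   Context: All Banach spaces are real and nontrivial ($\neq\{0\}$), with norm denoted $|\cdot|$. A subspace of a Banach space means a closed linear subspace $\neq\{0\}$. $\mathcal{L}(V,Y)$ is the Banach space of continuous linear mappings $V\to Y$ with the operator norm. Let $V$ be a closed subspace of $X$, $G\subset X$ open, $a\in G$, $f:G\to Y$. $f$ is Fréchet differentiable at $a$ along $V$ if the mapping $g(v):=f(a+v)$, $v\in V\cap(G-a)$, is Fréchet differentiable at $0\in V$; then $f'_V(a):=g'(0)\in\mathcal{L}(V,Y)$. $f$ is strictly differentiable at $a$ along $V$ if $f'_V(a)$ exists and $$\lim_{(x,\tilde x)\to(a,a),\ 0\neq \tilde x-x\in V}\frac{|f(\tilde x)-f(x)-f'_V(a)(\tilde x-x)|}{|\tilde x-x|}=0.$$ A first category (meagre) set is a countable union of nowhere dense sets. *)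

(* Defs.v *)
From HB Require Import structures.
From mathcomp Require Import all_boot all_order all_algebra.
From mathcomp Require Import all_classical all_reals all_analysis.

Set Implicit Arguments.
Unset Strict Implicit.
Unset Printing Implicit Defensive.

Import Order.TTheory GRing.Theory Num.Theory.
Import numFieldNormedType.Exports.

Local Open Scope classical_set_scope.
Local Open Scope ring_scope.

(* A linear subspace V of X, as a normed space with the norm induced by X. *)
Section SubspaceType.
Context (R : realType) (X : normedModType R) (V : submodClosed X).

Definition subspaceT := {x : X | x \in V}.

HB.instance Definition _ := SubChoice.on subspaceT.
HB.instance Definition _ := [SubChoice_isSubLmodule of subspaceT by <:].

Let sub_norm (v : subspaceT) : R := `|val v|.

Let sub_normD (u v : subspaceT) : sub_norm (u + v) <= sub_norm u + sub_norm v.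
Proof. by rewrite /sub_norm raddfD ler_normD. Qed.

Let sub_normZ (l : R) (v : subspaceT) : sub_norm (l *: v) = `|l| * sub_norm v.
Proof. by rewrite /sub_norm linearZ normrZ. Qed.

Let sub_norm_eq0 (v : subspaceT) : sub_norm v = 0 -> v = 0.
Proof. by move=> /normr0_eq0 v0; apply: val_inj; rewrite v0 raddf0. Qed.

HB.instance Definition _ :=
  Lmodule_isNormed.Build R subspaceT sub_normD sub_normZ sub_norm_eq0.

Lemma subspace_normE (v : subspaceT) : `|v| = `|val v|.
Proof. by []. Qed.

End SubspaceType.

(* The space L(U, W) of continuous linear maps with the operator norm. *)
Section ContinuousLinear.
Context (R : realType) (U W : normedModType R).

Definition clinear : {pred U -> W} :=
  [pred f | `[< linear f /\ continuous f >]].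

Lemma clinearP (f : U -> W) : reflect (linear f /\ continuous f) (f \in clinear).
Proof. exact: asboolP. Qed.

Let clinear_submod : submod_closed clinear.
Proof.
split.
  apply/clinearP; split; last exact: cst_continuous.
  by move=> a u v /=; rewrite scaler0 addr0.
move=> a f g /clinearP[fl fc] /clinearP[gl gc]; apply/clinearP; split.
  move=> b u v; rewrite !fctE fl gl !scalerDr !scalerA (mulrC a b).
  by rewrite addrACA.
move=> x; apply: cvgD; last exact: gc.
by apply: cvgZr; exact: fc.
Qed.

HB.instance Definition _ := GRing.isSubmodClosed.Build _ _ clinear
  clinear_submod.

Definition clinearT := {f : U -> W | f \in clinear}.

HB.instance Definition _ := SubChoice.on clinearT.
HB.instance Definition _ := [SubChoice_isSubLmodule of clinearT by <:].

Definition op_norm (f : clinearT) : R :=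
  sup [set `|val f x| | x in [set x : U | `|x| <= 1]].

Let op_norm_bounded (f : clinearT) :
  exists M, forall x, `|val f x| <= M * `|x|.
Proof.
case: f => f /= /clinearP[fl fc].
pose fL := HB.pack_for {linear U -> W} f (GRing.isLinear.Build _ _ _ _ f fl).
have /linear_boundedP/pinfty_ex_gt0[M _ H] : bounded_near fL (nbhs 0).
  by apply: continuous_linear_bounded; exact: fc.
by exists M.
Qed.

Let op_norm_linear (f : clinearT) : linear (val f).
Proof. by case: f => f /= /clinearP[]. Qed.

Let val0 (f : clinearT) : val f 0 = 0.
Proof.
have := op_norm_linear f 1 0 0.
by rewrite scaler0 addr0 scale1r => /eqP; rewrite -subr_eq subrr => /eqP.
Qed.

Let valZ (f : clinearT) a x : val f (a *: x) = a *: val f x.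
Proof. by have := op_norm_linear f a x 0; rewrite !addr0 val0 addr0. Qed.

Let op_norm_has_sup (f : clinearT) :
  has_sup [set `|val f x| | x in [set x : U | `|x| <= 1]].
Proof.
split; first by exists `|val f 0|, 0 => //=; rewrite normr0.
have [M fM] := op_norm_bounded f; exists `|M| => _ [x /= x1 <-].
rewrite (le_trans (fM x))// (le_trans (ler_wpM2r _ (ler_norm M)))//.
by rewrite ler_piMr.
Qed.

Let op_norm_ub (f : clinearT) x : `|x| <= 1 -> `|val f x| <= op_norm f.
Proof.
by move=> x1; apply: ub_le_sup; [case: (op_norm_has_sup f)|exists x].
Qed.

Let op_norm_least (f : clinearT) M :
  (forall x, `|x| <= 1 -> `|val f x| <= M) -> op_norm f <= M.
Proof.
move=> fM; apply: ge_sup; first by case: (op_norm_has_sup f).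
by move=> _ [x /= x1 <-]; exact: fM.
Qed.

Let op_normD (f g : clinearT) : op_norm (f + g) <= op_norm f + op_norm g.
Proof.
apply: op_norm_least => x x1.
by rewrite raddfD (le_trans (ler_normD _ _))// lerD// op_norm_ub.
Qed.

Let op_normZ_le (l : R) (f : clinearT) : op_norm (l *: f) <= `|l| * op_norm f.
Proof.
apply: op_norm_least => x x1.
by rewrite linearZ/= fctE normrZ ler_wpM2l// op_norm_ub.
Qed.

Let op_normZ (l : R) (f : clinearT) : op_norm (l *: f) = `|l| * op_norm f.
Proof.
apply/eqP; rewrite eq_le op_normZ_le/=.
have [->|l0] := eqVneq l 0.
  rewrite normr0 mul0r; have := @op_norm_ub (0 *: f) 0.
  by rewrite normr0 ler01 => /(_ isT); apply: le_trans.
rewrite -ler_pdivlMl ?normr_gt0// -normfV.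
by have := op_normZ_le l^-1 (l *: f); rewrite scalerA mulVf// scale1r.
Qed.

Let op_norm_eq0 (f : clinearT) : op_norm f = 0 -> f = 0.
Proof.
move=> f0; apply: val_inj; apply/funext => x; rewrite raddf0 /=.
have [->|x0] := eqVneq x 0; first by rewrite val0.
have : `|val f (`|x|^-1 *: x)| <= 0.
  rewrite -f0 op_norm_ub// normrZ normfV normr_id mulVf ?normr_eq0//.
rewrite normr_le0 valZ scaler_eq0 invr_eq0 normr_eq0 (negbTE x0)/=.
by move=> /eqP.
Qed.

HB.instance Definition _ :=
  Lmodule_isNormed.Build R clinearT op_normD op_normZ op_norm_eq0.

Lemma clinear_normE (f : clinearT) :
  `|f| = sup [set `|val f x| | x in [set x : U | `|x| <= 1]].
Proof. by []. Qed.

End ContinuousLinear.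

Section Topology.
Context (T : topologicalType).

Definition separable := exists D : set T, countable D /\ dense D.

Definition nowhere_dense (A : set T) := interior (closure A) = set0.

Definition first_category (A : set T) :=
  exists F : (set T)^nat,
    (forall n, nowhere_dense (F n)) /\ A = \bigcup_n F n.

End Topology.
Arguments separable : clear implicits.

(* A map on an open set G is represented by a total function X -> Y. For a in
   G, the notions below depend only on the values of f near a, hence only on
   the restriction of f to G. *)
Section DifferentiabilityAlong.
Context (R : realType) (X Y : normedModType R) (V : submodClosed X).

Definition translate (f : X -> Y) (a : X) : subspaceT V -> Y :=
  fun v => f (a + val v).

Definition differentiable_along (f : X -> Y) (a : X) :=
  differentiable (translate f a) 0.

Definition diff_along (f : X -> Y) (a : X) : {linear subspaceT V -> Y} :=
  'd (translate f a) 0.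

(* The pairs p = (x, x~) range over a punctured neighbourhood of (a, a) with
   0 != x~ - x \in V; there insubd 0 (x~ - x) is x~ - x seen as a point of V,
   and the default value 0 is never used. *)
Definition strictly_differentiable_along (f : X -> Y) (a : X) :=
  differentiable_along f a /\
  (`|f p.2 - f p.1 - diff_along f a (insubd 0 (p.2 - p.1))| / `|p.2 - p.1|)
    @[p --> within [set p : X * X | p.2 - p.1 != 0 /\ p.2 - p.1 \in V]
                   (nbhs (a, a))] --> (0 : R).

End DifferentiabilityAlong.

(* Main.v *)
(* Fix a countable dense set of operators L in L(V, Y). The set F(L, e, d) of
   the points a of G at which |f(a + v) - f(a) - L v| <= e |v| for all v in V
   with |v| < d and a + v in G is relatively closed in G by continuity of f, so
   F minus its interior is nowhere dense. Countably many triples (L, e, d)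
   suffice: if f is differentiable along V at a and e > 0, then a lies in
   F(L, e, d) for some L close to f'_V(a) and some small d; if a is moreover
   interior to F(L, e, d), the estimate holds uniformly at all points near a,
   and as this happens for every e, f is strictly differentiable at a. *)

From HB Require Import structures.
Require Import Defs.
From mathcomp Require Import all_boot all_order all_algebra.
From mathcomp Require Import all_classical all_reals all_analysis.
From mathcomp Require Import lra.

Import Order.TTheory GRing.Theory Num.Theory.
Import numFieldNormedType.Exports.

Local Open Scope classical_set_scope.
Local Open Scope ring_scope.

Lemma nowhere_denseS (T : topologicalType) (A B : set T) :
  A `<=` B -> nowhere_dense B -> nowhere_dense A.
Proof.
move=> AB; rewrite /nowhere_dense -!subset0 => B0.
exact: subset_trans (interiorS (closureS AB)) B0.
Qed.

Lemma nowhere_dense0 (T : topologicalType) : nowhere_dense (@set0 T).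
Proof. by rewrite /nowhere_dense closure0 interior0. Qed.

(** An injection of [D] into the naturals turns the family into a sequence. [first_category] asks
    for an equality, so each piece is cut down to [A]; a number that codes no index gets the empty
    set. *)
Lemma first_category_sub_bigcup (T : topologicalType) (I : Type) (D : set I)
    (N : I -> set T) (A : set T) :
  countable D -> (forall i, D i -> nowhere_dense (N i)) ->
  A `<=` \bigcup_(i in D) N i -> first_category A.
Proof.
move=> /countable_injP[g ginj] Nnd AN.
exists (fun n => [set x | A x /\ exists i, [/\ D i, g i = n & N i x]]); split.
- move=> n; have [[i [Di gi]]|noi] := pselect (exists i, D i /\ g i = n).
    apply: nowhere_denseS (Nnd _ Di) => x /= [_ [j [Dj gj]]].
    by rewrite (ginj i j) ?inE// gi.
  apply: nowhere_denseS (@nowhere_dense0 T) => x /= [_ [j [Dj gj _]]].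
  by apply: noi; exists j.
- apply/seteqP; split => [x Ax|x [n _ []//]].
  by have [i Di Nix] := AN _ Ax; exists (g i) => //; split => //; exists i.
Qed.

(** A nonempty open [U] inside the closure of [F] minus its interior would contain some [y] of that
    difference. Then [U] meets [G] in a neighbourhood of [y] lying in [closure F], hence in [F], so
    [y] would be interior to [F]. *)
Lemma relatively_closed_boundary (T : topologicalType) (G F : set T) :
  open G -> F `<=` G -> closure F `&` G `<=` F -> nowhere_dense (F `\` F°).
Proof.
move=> oG FG Fcl; rewrite /nowhere_dense -subset0 => x Ux.
set U := (closure (F `\` F°))° in Ux.
have oU : open U by exact: open_interior.
have UclF : U `<=` closure F.
  by apply: subset_trans (@interior_subset _ _) (closureS _) => y [].
have [y [[Fy nFy] Uy]] : (F `\` F°) `&` U !=set0.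
  by apply: (interior_subset Ux); exact: open_nbhs_nbhs.
apply: nFy; apply: (@filterS _ _ _ (U `&` G)).
  by move=> z [Uz Gz]; apply: Fcl; split => //; exact: UclF.
by apply: open_nbhs_nbhs; split; [exact: openI|split => //; exact: FG].
Qed.

Lemma differentiable0_norm_le (R : realType) (U W : normedModType R)
    (g : U -> W) (e : R) : differentiable g 0 -> 0 < e ->
  exists2 d : R, 0 < d &
    forall v, `|v| < d -> `|g v - g 0 - 'd g 0 v| <= e * `|v|.
Proof.
move=> /diff_locally /eqaddoP H /H /nbhs_norm0P[d d0 {}H]; exists d => // v vd.
by have := H v vd; rewrite !fctE /= addr0 opprD addrA.
Qed.

(** Rescaling reduces to unit vectors; boundedness of [L] ensures that the supremum defining the
    norm is an upper bound. *)
Lemma clinear_norm_le (R : realType) (U W : normedModType R)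
    (L : clinearT U W) (x : U) : `|val L x| <= `|L| * `|x|.
Proof.
have /clinearP[Ll Lc] := valP L.
pose fL := HB.pack_for {linear U -> W} (val L)
  (GRing.isLinear.Build _ _ _ _ (val L) Ll).
have fLE : val L = fL by [].
have [M _ HM] : exists2 M : R, 0 < M & forall y, `|fL y| <= M * `|y|.
  apply: pinfty_ex_gt0; apply/linear_boundedP.
  by apply: continuous_linear_bounded; exact: Lc.
have [->|x0] := eqVneq x 0; first by rewrite fLE linear0 !normr0 mulr0.
have nx0 : 0 < `|x| by rewrite normr_gt0.
rewrite -ler_pdivrMr// mulrC.
have -> : `|x|^-1 * `|val L x| = `|val L (`|x|^-1 *: x)|.
  by rewrite fLE linearZ/= normrZ normfV normr_id.
rewrite clinear_normE; apply: ub_le_sup; last first.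
  by exists (`|x|^-1 *: x) => //=; rewrite normrZ normfV normr_id mulVf ?gt_eqF.
exists `|M| => _ [y /= y1 <-].
rewrite fLE (le_trans (HM y))// (le_trans (ler_wpM2r _ (ler_norm M)))//.
by rewrite ler_piMr.
Qed.

Section AlmostLinearIncrements.
Context (R : realType) (X Y : normedModType R) (V : submodClosed X).
Implicit Types (G : set X) (f : X -> Y) (L : subspaceT V -> Y) (e d : R).

Definition almost_linear_increments G f L e d : set X :=
  [set a | G a /\ forall v : subspaceT V, `|v| < d -> G (a + val v) ->
    `|f (a + val v) - f a - L v| <= e * `|v|].

(** For a fixed [v], violating the estimate is a strict inequality between quantities continuous in
    the base point, so it would persist at nearby points of the set. *)
Lemma almost_linear_increments_closed G f L e d :
  open G -> {within G, continuous f} ->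
  closure (almost_linear_increments G f L e d) `&` G `<=`
  almost_linear_increments G f L e d.
Proof.
move=> oG; rewrite continuous_open_subspace// => fc a [cla Ga].
split => // v vd Gav; rewrite leNgt; apply/negP => lt_av.
have cav : (x + val v) @[x --> a] --> a + val v by apply: cvgD => //; exact: cvg_cst.
have : \forall x \near a, e * `|v| < `|f (x + val v) - f x - L v|.
  apply: (@cvgr_gt R _ (nbhs a) _ (fun x => `|f (x + val v) - f x - L v|)) lt_av.
  apply: cvg_norm; apply: cvgB; last exact: cvg_cst.
  apply: cvgB; last by apply: fc; rewrite inE.
  by apply: cvg_comp cav _; apply: fc; rewrite inE.
have : \forall x \near a, G (x + val v).
  by apply: cav; apply: open_nbhs_nbhs.
move=> H1 H2; have [x [[Gx Hx] [Gxv]]] := cla _ (filterI H1 H2).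
by rewrite ltNge Hx.
Qed.

Lemma almost_linear_increments_interior G f (L : subspaceT V -> Y) e d a :
  0 < d -> (almost_linear_increments G f L e d)° a ->
  \forall p \near (a, a), forall v : subspaceT V, p.2 - p.1 = val v ->
    `|f p.2 - f p.1 - L v| <= e * `|v|.
Proof.
move=> d0 /nbhs_ballP[r /= r0 ar].
(* Two points within [d / 2] of [a] differ by less than [d], so their difference is an admissible
   increment; radius [r] keeps both in the set. *)
have s0 : 0 < Num.min r (d / 2) by rewrite lt_min r0 divr_gt0.
apply/nbhs_ballP; exists (Num.min r (d / 2)) => // -[x y] /= [].
rewrite /= -!ball_normE /= !lt_min => /andP[xr xd] /andP[yr yd] v xyv.
have Ex : x + val v = y by rewrite -[y](subrK x) addrC; congr (_ + _).
have [Gx] : almost_linear_increments G f L e d x by apply: ar; rewrite -ball_normE.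
have [Gy _] : almost_linear_increments G f L e d y by apply: ar; rewrite -ball_normE.
move=> /(_ v); rewrite Ex; apply => //.
have -> : `|v| = `|y - x| by rewrite subspace_normE; congr `|_|.
by have := ler_distD a y x; rewrite (distrC y a); lra.
Qed.

End AlmostLinearIncrements.

Theorem theorem4p1 (R : realType) (X Y : completeNormedModType R)
    (hX : exists x : X, x != 0) (hY : exists y : Y, y != 0)
    (V : submodClosed X) (V_closed : closed [set x : X | x \in V])
    (V_neq0 : exists2 v : X, v \in V & v != 0)
    (sepL : separable (clinearT (subspaceT V) Y))
    (G : set X) (G_open : open G)
    (f : X -> Y) (f_cont : {within G, continuous f}) :
  first_category
    [set a : X | [/\ G a, differentiable_along V f a
                        & ~ strictly_differentiable_along V f a]].
Proof.
have [D [Dcount Ddense]] := sepL.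
pose F (i : clinearT (subspaceT V) Y * nat * nat) :=
  almost_linear_increments R X Y V G f (val i.1.1) i.1.2.+1%:R^-1 i.2.+1%:R^-1.
apply: (@first_category_sub_bigcup _ _ (D `*` setT `*` setT)
  (fun i => F i `\` (F i)°)).
- by do 2 apply: countableX => //.
- move=> i _; apply: (@relatively_closed_boundary _ G) => //; first by move=> x [].
  exact: almost_linear_increments_closed.
(* By contraposition: if [a] avoids every [F i] minus its interior, then it is interior to each
   [F i] with index in the family that contains it. *)
move=> a [Ga fa nsa]; apply: contrapT => naF; apply: nsa; split => //.
set d := diff_along V f a.
have dc : continuous d by exact: diff_continuous.
(* The derivative becomes a point of the operator space, where density of [D] applies. *)
have dP : (d : _ -> _) \in @clinear R (subspaceT V) Y.
  by apply/clinearP; split => // c u v; rewrite linearP.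
pose dL : clinearT (subspaceT V) Y := exist _ (d : _ -> _) dP.
apply/cvgr0Pnorm_le => eps eps0; rewrite near_withinE.
have [n] := @ltr_add_invr R 0 (eps / 2) (divr_gt0 eps0 (ltr0n _ 2)).
rewrite add0r => neps.
have n0 : 0 < n.+1%:R^-1 :> R by rewrite invr_gt0.
have n20 : 0 < n.+1%:R^-1 / 2 :> R by rewrite divr_gt0.
(* Half of the tolerance 1/(n+1) pays for replacing [d] by [L], the other half for the
   differentiability error at [a]. *)
have [L [LdL DL]] : ball dL (n.+1%:R^-1 / 2) `&` D !=set0.
  by apply: Ddense; [exists dL; exact: ballxx|exact: ball_open].
have Ld v : `|d v - val L v| <= n.+1%:R^-1 / 2 * `|v|.
  have -> : d v - val L v = val (dL - L) v by [].
  apply: le_trans (clinear_norm_le _ _ _ _ _) _; rewrite ler_wpM2r//.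
  by move: LdL; rewrite -ball_normE /= => /ltW.
have [r r0 Hr] := differentiable0_norm_le _ _ _ _ _ fa n20.
have [k] := @ltr_add_invr R 0 r r0; rewrite add0r => kr.
have Fa : F (L, n, k) a.
  split => //= v vk _.
  have := Hr v (lt_trans vk kr).
  rewrite /translate raddf0 addr0 -/(diff_along V f a) -/d => Hv.
  have -> : f (a + val v) - f a - val L v =
      (f (a + val v) - f a - d v) + (d v - val L v) by rewrite addrA subrK.
  apply: le_trans (ler_normD _ _) _; apply: le_trans (lerD Hv (Ld v)) _.
  by rewrite -mulrDl -splitr.
have Fia : (F (L, n, k))° a.
  by apply: contrapT => nia; apply: naF; exists (L, n, k).
have k0 : 0 < k.+1%:R^-1 :> R by rewrite invr_gt0.
have := almost_linear_increments_interior _ _ _ _ _ _ _ _ _ _ k0 Fia.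
apply: filterS => -[x y] /= H [xy0 xyV].
(* Since [y - x] lies in [V], [insubd] does not return its default 0. *)
have vE : y - x = val (insubd 0 (y - x) : subspaceT V) by rewrite insubdK.
have := H _ vE; set v := insubd _ _ => Hv.
have nv : 0 < `|y - x| by rewrite normr_gt0.
have nE : `|v| = `|y - x| by rewrite subspace_normE -vE.
rewrite normrM normfV !normr_id ler_pdivrMr//.
have -> : f y - f x - d v = (f y - f x - val L v) - (d v - val L v).
  by rewrite opprB addrA subrK.
apply: le_trans (ler_normB _ _) _.
rewrite nE in Hv; have := Ld v; rewrite nE => Lv.
apply: le_trans (lerD Hv Lv) _; rewrite -mulrDl ler_wpM2r//.
(* Going back from [L] to [d] costs another half of 1/(n+1); the total is below 3/4 of [eps]. *)
have le_eps (q t : R) : 0 < q -> q < t / 2 -> q + q / 2 <= t by lra.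
exact: le_eps.
Qed.
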